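(* For every integer $k\geq 3$, if $n$ is large enough (depending on $k$), then every $p\in S_n$ has a $2$-multiplicative subsequence of length $k$.
   Context: $S_n$ denotes the set of permutations of $\{1,2,\ldots,n\}$ written in one-line notation $p=(p_1,p_2,\ldots,p_n)$. A subsequence of $p$ of length $k$ is a sequence $(p_{i_1},\ldots,p_{i_k})$ with $i_1<\cdots<i_k$. A sequence $(a_1,a_2,\ldots,a_k)$ of positive integers is $2$-multiplicative if $a_1a_2\cdots a_k=a_1^2$ or $a_1a_2\cdots a_k=a_k^2$. *)

(* Defs.v *)
From mathcomp Require Import all_boot all_fingroup.

Set Implicit Arguments.
Unset Strict Implicit.
Unset Printing Implicit Defensive.

(* ['S_n] permutes ['I_n] = {0, ..., n-1}, hence the shift by one. *)
Definition one_line (n : nat) (p : 'S_n) : seq nat :=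
  [seq (p i).+1 | i <- enum 'I_n].

(* The default 0 of [head] and [last] is reached only for the empty sequence,
   which is thus not 2-multiplicative (its product is 1). *)
Definition two_multiplicative (a : seq nat) : Prop :=
  \prod_(x <- a) x = head 0 a ^ 2 \/ \prod_(x <- a) x = last 0 a ^ 2.

(* Main.v *)
Require Import Defs.
From mathcomp Require Import all_boot all_fingroup.
From Stdlib Require Import Classical.
From mathcomp Require Import zify.

(** Restrict attention to the powers of 2: the places of 2 ^ 1, 2 ^ 2, ... in
    the permutation give a strict total order r on exponents, and products
    become sums.  With q = k - 1, it is enough to find q distinct positive
    integers, of bounded size, whose sum is r-before all of them or r-after all
    of them ([extremal_sum]).

    Suppose that there are none, so that every sum of q distinct positive
    integers lies strictly between its r-least and r-greatest summands.  Let c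
    be the r-median of 1, ..., 2q - 1, let S be the set of the q - 1 numbers
    before it and S' the set of those after it, with sums s and s'.  Take x
    larger than 2q - 1 and apply the assumption to the q numbers x and S'.  If
    x is above c, all summands are above c, hence so is their sum x + s'; if x is
    below c, then x is the least summand, so x + s' is above x
    ([pushes_up_sumn]).  Symmetrically, adding s keeps below c what is below c.

    Put L = s * s' and let t0 * L be a large multiple of L, say below c (the
    other case is the same for the converse order).  Adding s repeatedly, all
    later multiples of L are below c.  A step from one multiple of L to the next
    is also a number of additions of s'; none of its intermediate values can be
    above c, since adding s' would keep it there, hence each addition moves up.
    So the multiples of L are r-increasing from t0 * L on, and the sum of q
    consecutive ones, a later multiple of L, is r-after all of them: a
    contradiction ([low_multiple_absurd]). *)

Set Implicit Arguments.
Unset Strict Implicit.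

(** * Orders in which no sum comes first *)

Definition strict_total (r : rel nat) : Prop :=
  [/\ irreflexive r, transitive r & forall x y, x != y -> r x y || r y x].

(** Taken for r and for its converse, this is the negation of the existence of
    an extremal sum; the two halves are kept apart so that one lemma, applied to
    both orders, handles both sides of the pivot c. *)
Definition no_sum_first (r : rel nat) (q E : nat) : Prop :=
  forall xs, uniq xs -> size xs = q -> 0 \notin xs -> sumn xs <= E ->
  ~~ all (r (sumn xs)) xs.

(** Adding s to a number above c leaves it above c, and adding s to a number
    below c moves it up.  The bounds B and E confine this to x that are none of
    the fixed small summands and to sums that are still controlled. *)
Definition pushes_up (r : rel nat) (c s B E : nat) : Prop :=
  forall x, B < x -> x + s <= E ->
  (r c x -> r c (x + s)) /\ (r x c -> r x (x + s)).

Definition converse (r : rel nat) : rel nat := fun x y => r y x.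

Lemma strict_total_converse r : strict_total r -> strict_total (converse r).
Proof.
case=> irr tr tot; split=> [x|y x z ryx rzy|x y neq]; first exact: irr.
  exact: tr rzy ryx.
by rewrite /converse orbC tot.
Qed.

(** If either conclusion failed, x + sumn S would come before x and before
    c, hence before all of S: it would be an r-first sum of q + 1 numbers. *)
Lemma pushes_up_sumn r q B E c S :
  strict_total r -> no_sum_first r q.+1 E -> c <= B ->
  uniq S -> size S = q -> 0 < q -> {subset S <= iota 1 B} -> all (r c) S ->
  pushes_up r c (sumn S) B E.
Proof.
move=> [irr tr tot] noF leB uS sS q0 sub above x ltB leE.
have xS : x \notin S by apply/negP => /sub; rewrite mem_iota; lia.
have S0 : 0 \notin S by apply/negP => /sub; rewrite mem_iota.
have s0 : 0 < sumn S.
  case: S sS S0 {uS sub above leE xS} => [|y S] /=; first by lia.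
  by rewrite inE negb_or; lia.
have key z : r z x -> r z c -> z = x + sumn S -> False.
  move=> rzx rzc ez; have := noF (x :: S).
  rewrite /= xS uS sS inE (negbTE S0) orbF -ez rzx /=.
  have -> : all (r z) S by apply/allP => y /(allP above); apply: tr rzc.
  by move=> H; suff: ~~ true by []; apply: H => //; lia.
split=> [rcx | rxc].
  have /tot/orP[//|rc] : c != x + sumn S by lia.
  by case: (key _ _ rc (erefl _)); apply: tr rc rcx.
have /tot/orP[//|rx] : x != x + sumn S by lia.
by case: (key _ rx _ (erefl _)); apply: tr rx rxc.
Qed.

Lemma pushes_up_above r c s B E x j :
  pushes_up r c s B E -> B < x -> x + j * s <= E -> r c x -> r c (x + j * s).
Proof.
move=> push ltB; elim: j => [|j IHj] leE rcx; first by rewrite addn0.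
rewrite mulSn addnCA addnC.
by apply: (push _ _ _).1; [lia | lia | apply: IHj => //; lia].
Qed.

(** Since being above c persists, an endpoint not above c forces all
    intermediate values below c, where every addition of s moves up. *)
Lemma pushes_up_rise r c s B E x j :
  strict_total r -> pushes_up r c s B E -> c <= B -> B < x -> x + j * s <= E ->
  0 < j -> ~~ r c (x + j * s) -> r x (x + j * s).
Proof.
move=> [irr tr tot] push leB ltB; case: j => // j leE _.
elim: j leE => [|j IHj] leE nr.
  rewrite mul1n in leE nr *; apply: (push _ _ _).2 => //.
  have /tot/orP[rcx|//] : c != x by lia.
  by case/negP: nr; apply: (push _ _ _).1.
have e : x + j.+2 * s = x + j.+1 * s + s by lia.
have nrj : ~~ r c (x + j.+1 * s).
  by apply: contra nr => rj; rewrite e; apply: (push _ _ _).1 => //; lia.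
apply: tr (IHj _ nrj) _; first by lia.
rewrite e; apply: (push _ _ _).2; [lia | lia |].
have /tot : c != x + j.+1 * s by lia.
by rewrite (negbTE nrj).
Qed.

(** * Extremal sums *)

Lemma sumn_iotaS t n : sumn (iota t n.+1) = t + sumn (iota t.+1 n).
Proof. by []. Qed.

Lemma leq_sumn_iota t n : t + n <= sumn (iota t n.+1).
Proof.
elim: n t => [|n IHn] t; first by rewrite /= !addn0.
by have := IHn t.+1; rewrite [sumn (iota t _)]sumn_iotaS; lia.
Qed.

Lemma sumn_map_mull (L : nat) s : sumn [seq t * L | t <- s] = sumn s * L.
Proof. by elim: s => //= t s ->; rewrite mulnDl. Qed.

(** The multiples of s * s' can be walked through in steps of s, which keep them
    below c, and in steps of s', which make them increase; so the sum of
    q + 2 consecutive multiples comes last, which the hypothesis on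
    converse r forbids. *)
Lemma low_multiple_absurd r q E B c s s' t0 :
  strict_total r -> c <= B -> 0 < s -> 0 < s' ->
  pushes_up r c s' B E -> pushes_up (converse r) c s B E ->
  no_sum_first (converse r) q.+2 E ->
  B < t0 -> sumn (iota t0 q.+2) * (s * s') <= E -> r (t0 * (s * s')) c -> False.
Proof.
move=> tot_r leB s0 s'0 up down noF ltB leE low0.
have [irr tr _] := tot_r.
set L := s * s' in leE low0; have L0 : 0 < L by rewrite muln_gt0 s0.
have ltBL t : t0 <= t -> B < t * L by nia.
have low t : t0 <= t -> t * L <= E -> r (t * L) c.
  move=> le_t tE.
  have e : t * L = t0 * L + ((t - t0) * s') * s by rewrite /L; nia.
  by rewrite e; apply: (pushes_up_above down) => //; rewrite -?e ?ltBL.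
have incr t t' : t0 <= t -> t < t' -> t' * L <= E -> r (t * L) (t' * L).
  move=> le_t lt_t tE.
  have e : t' * L = t * L + ((t' - t) * s) * s' by rewrite /L; nia.
  rewrite e; apply: (pushes_up_rise tot_r up) => //; rewrite -?e ?ltBL //.
    by rewrite muln_gt0 s0 subn_gt0 lt_t.
  by apply/negP => rc; have := tr _ _ _ rc (low _ (leq_trans le_t (ltnW lt_t)) tE); rewrite irr.
have sumE := sumn_map_mull L (iota t0 q.+2).
(* The summands are t * L for t0 <= t < t0 + q + 2, and their sum is T * L
   with T at least t0 + (t0 + 1 + q): this exceeds each t since t0 > 0. *)
suff: ~~ all (converse r (sumn (iota t0 q.+2) * L)) [seq t * L | t <- iota t0 q.+2].
  case/negP; apply/allP => _ /mapP[t + ->]; rewrite mem_iota => /andP[le_t lt_t].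
  apply: incr => //; apply: leq_trans (_ : (t0 + (t0.+1 + q)) <= _); first by lia.
  by rewrite sumn_iotaS leq_add2l leq_sumn_iota.
rewrite -sumE; apply: noF.
- rewrite map_inj_uniq ?iota_uniq // => x y /eqP.
  by rewrite eqn_pmul2r // => /eqP.
- by rewrite size_map size_iota.
- by apply/mapP => -[t]; rewrite mem_iota; nia.
- by rewrite sumE.
Qed.

Lemma median_pivot r q : strict_total r ->
  exists c S S', [/\ c <= q.*2.+1, uniq S, uniq S', size S = q & size S' = q] /\
  [/\ {subset S <= iota 1 q.*2.+1}, {subset S' <= iota 1 q.*2.+1},
      all (converse r c) S & all (r c) S'].
Proof.
move=> tot_r; have [irr tr tot] := tot_r.
pose le x y := (x == y) || r x y.
have le_tot : total le.
  by move=> x y; rewrite /le eq_sym; case: (eqVneq y x) => //= /tot; rewrite orbC.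
have le_tr : transitive le.
  move=> y x z /orP[/eqP->//|rxy] /orP[/eqP<-|ryz]; rewrite /le ?rxy ?orbT //.
  by rewrite (tr _ _ _ rxy ryz) orbT.
set w := sort le (iota 1 q.*2.+1).
have ms : w =i iota 1 q.*2.+1 by apply: mem_sort.
have uw : uniq w by rewrite sort_uniq iota_uniq.
have sw : size w = q.*2.+1 by rewrite size_sort size_iota.
have ow : sorted le w by apply: sort_sorted.
have ew : w = take q w ++ nth 0 w q :: drop q.+1 w.
  by rewrite -drop_nth ?cat_take_drop // sw; lia.
have sS : size (take q w) = q by rewrite size_take sw; case: ltnP => //; lia.
have sS' : size (drop q.+1 w) = q by rewrite size_drop sw; lia.
move: ew sS sS'; move: (take q w) (nth 0 w q) (drop q.+1 w) => S c S' ew sS sS'.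
exists c, S, S'.
move: uw ow; rewrite ew cat_uniq /= negb_or => /and3P[-> /andP[cS _] /andP[cS' ->]].
rewrite (sorted_pairwise le_tr) pairwise_cat allrel_consr /= => /and3P[/andP[Sc _] _ /andP[cle _]].
have cw : c \in w by rewrite ew mem_cat mem_head orbT.
split; split=> //.
- by move: cw; rewrite ms mem_iota; lia.
- by move=> x xS; rewrite -ms ew mem_cat xS.
- by move=> x xS; rewrite -ms ew mem_cat inE xS !orbT.
- apply/allP => x xS; have /orP[/eqP e|//] := allP Sc _ xS.
  by rewrite -e xS in cS.
- apply/allP => x xS; have /orP[/eqP e|//] := allP cle _ xS.
  by rewrite e xS in cS'.
Qed.

Lemma sumn_gt0_leq S n : {subset S <= iota 1 n} -> 0 < size S ->
  0 < sumn S <= size S * n.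
Proof.
move=> sub S0; apply/andP; split.
  case: S sub S0 => //= x S sub _.
  by have := sub x (mem_head _ _); rewrite mem_iota; lia.
elim: S sub {S0} => //= x S IHS sub; rewrite mulSn leq_add //.
  by have := sub x (mem_head _ _); rewrite mem_iota; lia.
by apply: IHS => y yS; apply: sub; rewrite inE yS orbT.
Qed.

(** For at least two summands: every strict total order on the integers admits
    a sum of distinct positive integers that is extremal among its summands,
    with a bound E uniform in the order. *)
Lemma extremal_sum q : exists E, forall r, strict_total r ->
  exists xs, [/\ uniq xs, size xs = q.+2, 0 \notin xs, sumn xs <= E &
    all (r (sumn xs)) xs || all (converse r (sumn xs)) xs].
Proof.
set B := q.+1.*2.+1; set W := q.+1 * B.
(* S and S' have q + 1 elements of size at most B, so their sums are at most W;
   the largest sum to be considered is that of the q + 2 multiples of s * s'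
   starting at (B + 1) * (s * s'). *)
exists (sumn (iota B.+1 q.+2) * (W * W)) => r tot_r.
set E := _ * _; apply: NNPP => none.
have noF : no_sum_first r q.+2 E.
  move=> xs uxs sxs x0 xE; apply/negP => first; apply: none.
  by exists xs; split; rewrite ?first.
have noL : no_sum_first (converse r) q.+2 E.
  move=> xs uxs sxs x0 xE; apply/negP => last; apply: none.
  by exists xs; split; rewrite ?last ?orbT.
have tot_r' := strict_total_converse tot_r.
have [c [S [S' [[leB uS uS' sS sS'] [subS subS' lowS highS']]]]] :=
  median_pivot q.+1 tot_r.
have /andP[s0 sW] : 0 < sumn S <= W by rewrite /W -[X in X * _]sS sumn_gt0_leq // sS.
have /andP[s'0 s'W] : 0 < sumn S' <= W by rewrite /W -[X in X * _]sS' sumn_gt0_leq // sS'.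
have up := pushes_up_sumn tot_r noF leB uS' sS' isT subS' highS'.
have down := pushes_up_sumn tot_r' noL leB uS sS isT subS lowS.
have [_ _ tot] := tot_r.
have LW : sumn S * sumn S' <= W * W by rewrite leq_mul.
have LE : sumn (iota B.+1 q.+2) * (sumn S * sumn S') <= E by rewrite leq_mul2l LW orbT.
have /tot/orP[low|high] : B.+1 * (sumn S * sumn S') != c by nia.
  by apply: (low_multiple_absurd tot_r leB s0 s'0 up down noL (ltnSn B) LE low).
rewrite mulnC [_ * sumn S']mulnC mulnC in high; rewrite [sumn S * _]mulnC in LE.
by apply: (low_multiple_absurd tot_r' leB s'0 s0 down up noF (ltnSn B) LE high).
Qed.

(** * Powers of 2 in a permutation *)

Lemma head_filter_mem (T : eqType) (x0 y : T) (s V : seq T) :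
  uniq s -> y \in s -> y \in V ->
  {in V, forall v, index y s <= index v s} -> head x0 [seq v <- s | v \in V] = y.
Proof.
move=> us ys; case/splitPr: ys us => l1 l2.
rewrite cat_uniq /= negb_or => /and3P[_ /andP[yl1 _] _] yV minV.
rewrite filter_cat /= yV (eq_in_filter (a2 := pred0)) ?filter_pred0 // => v vl1.
apply/negP => /minV; rewrite !index_cat vl1 (negbTE yl1).
by have : index v l1 < size l1 by [rewrite index_mem]; lia.
Qed.

Lemma last_filter_mem (T : eqType) (x0 y : T) (s V : seq T) :
  uniq s -> y \in s -> y \in V ->
  {in V, forall v, index v s <= index y s} -> last x0 [seq v <- s | v \in V] = y.
Proof.
move=> us ys; case/splitPr: ys us => l1 l2.
rewrite cat_uniq /= negb_or => /and3P[_ /andP[yl1 l12] /andP[yl2 _]] yV maxV.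
rewrite filter_cat /= yV last_cat /=.
rewrite (eq_in_filter (s := l2) (a2 := pred0)) ?filter_pred0 // => v vl2.
apply/negP => /maxV; rewrite !index_cat (negbTE yl1) /= eqxx.
rewrite (negbTE (hasPn l12 v vl2)).
by case: eqP => [e|_]; [rewrite e vl2 in yl2 | lia].
Qed.

Lemma one_line_uniq n (p : 'S_n) : uniq (one_line p).
Proof. by rewrite map_inj_uniq ?enum_uniq // => i j [/val_inj/perm_inj]. Qed.

Lemma mem_one_line n (p : 'S_n) x : (x \in one_line p) = (0 < x <= n).
Proof.
apply/mapP/idP => [[i _ ->]|]; first by rewrite ltnS ltn_ord.
case: x => //= x ltx; exists ((p^-1)%g (Ordinal ltx)); first by rewrite mem_enum.
by rewrite permKV.
Qed.

(** The place of 2 ^ e in p, continued by n + e beyond the range of p, where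
    every place is below n: this keeps the map injective on all exponents. *)
Definition exponent_place n (p : 'S_n) (e : nat) : nat :=
  if 2 ^ e <= n then index (2 ^ e) (one_line p) else n + e.

Lemma exponent_place_inj n (p : 'S_n) : injective (exponent_place p).
Proof.
have lt_n e : 2 ^ e <= n -> index (2 ^ e) (one_line p) < n.
  move=> le_n; rewrite -[X in _ < X]card_ord cardE -(size_map (fun i => (p i).+1)).
  by rewrite index_mem mem_one_line expn_gt0 le_n.
move=> e e'; rewrite /exponent_place.
case: ifP => [/[dup] le_n /lt_n lt|_]; case: ifP => [/[dup] le_n' /lt_n lt'|_]; try lia.
move=> /(congr1 (nth 0 (one_line p))).
rewrite !nth_index ?mem_one_line ?expn_gt0 ?le_n ?le_n' // => /eqP.
by rewrite eqn_exp2l // => /eqP.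
Qed.

Lemma strict_total_inj (f : nat -> nat) :
  injective f -> strict_total (fun x y => f x < f y).
Proof.
move=> inj; split=> [x|y x z|x y neq]; [exact: ltnn | exact: ltn_trans |].
by rewrite -neq_ltn (inj_eq inj).
Qed.

Lemma prod_pow2 xs : \prod_(x <- [seq 2 ^ e | e <- xs]) x = 2 ^ sumn xs.
Proof. by elim: xs => [|e xs IHxs]; rewrite ?big_nil // big_cons IHxs expnD. Qed.

Unset Implicit Arguments.

Theorem corollary6p2 (k : nat) (hk : 3 <= k) :
  exists N : nat, forall n : nat, N <= n -> forall p : 'S_n,
    exists a : seq nat,
      [/\ subseq a (one_line p), size a = k & two_multiplicative a].
Proof.
case: k hk => [|[|[|q]]] // _; have [E extremal] := extremal_sum q.
exists (2 ^ E) => n leE p.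
have [xs [uxs sxs x0 sE ext]] := extremal _ (strict_total_inj (@exponent_place_inj n p)).
set y := sumn xs in sE ext.
have le_n e : e <= E -> 2 ^ e <= n.
  by move=> eE; apply: leq_trans leE; rewrite leq_exp2l.
have xE e : e \in xs -> e <= E.
  by move=> /perm_to_rem/perm_sumn /= ey; rewrite /y in sE; lia.
have place e : e <= E -> exponent_place p e = index (2 ^ e) (one_line p).
  by move=> /le_n le; rewrite /exponent_place le.
have yxs : y \notin xs.
  by apply/negP => yxs; case/orP: ext => /allP/(_ _ yxs); rewrite /converse ltnn.
have uV : uniq [seq 2 ^ e | e <- y :: xs].
  by rewrite map_inj_uniq /= ?yxs // => e e' /eqP; rewrite eqn_exp2l // => /eqP.
set V := [seq _ | _ <- _] in uV.
have subV : {subset V <= one_line p}.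
  move=> _ /mapP[e + ->]; rewrite mem_one_line expn_gt0 inE => /orP[/eqP->|/xE/le_n //].
  exact: le_n.
have perm_a : perm_eq [seq v <- one_line p | v \in V] V.
  apply: uniq_perm => // [|v]; first by rewrite filter_uniq // one_line_uniq.
  by rewrite mem_filter; case: (boolP (v \in V)) => // /subV.
(* Listing V in the order of the permutation puts 2 ^ y at one end, and the
   product of V is 2 ^ y * 2 ^ y. *)
exists [seq v <- one_line p | v \in V]; split.
- exact: filter_subseq.
- by rewrite (perm_size perm_a) /= size_map sxs.
rewrite /two_multiplicative (perm_big _ perm_a) prod_pow2 /= -/y addnn -muln2 expnM.
have yV : 2 ^ y \in V by rewrite mem_head.
have uo := one_line_uniq p.
case/orP: ext => /allP ext; [left; rewrite (head_filter_mem _ uo (subV _ yV) yV) //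
                            |right; rewrite (last_filter_mem _ uo (subV _ yV) yV) //];
  move=> _ /mapP[e + ->]; rewrite inE => /orP[/eqP-> //|/[dup] /ext + /xE eE];
  by rewrite /converse !place // => /ltnW.
Qed.
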